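(* Let $n\ge 2$ be an integer, $\lambda=\frac{n-1}{2}$, let $y\in\mathbb{R}^{n+1}\setminus\{0\}$ and let $k\ge 0$ be an integer. Then for all $x\in\mathbb{R}^{n+1}\setminus\{0\}$, $$\left(\mathcal{K}\langle y,\nabla_x\rangle\mathcal{K}\right)^k[1](x)=(-1)^k\,k!\,C_k^{\lambda}(w)\,(|x||y|)^k=(-1)^k\,k!\,\frac{\lambda}{\lambda+k}\,Z_k^{\lambda}(x,y),\qquad w=\frac{\langle x,y\rangle}{|x||y|},$$ where $1$ denotes the constant function equal to $1$.
   Context: $\langle\cdot,\cdot\rangle$ and $|\cdot|$ are the Euclidean inner product and norm on $\mathbb{R}^{n+1}$. $\langle y,\nabla_x\rangle=\sum_{j} y_j\,\partial_{x_j}$ (sum over all $n+1$ coordinates) is the directional derivative in direction $y$, acting on smooth functions of $x\in\mathbb{R}^{n+1}\setminus\{0\}$. The Kelvin inversion, acting on functions of $x\in\mathbb{R}^{n+1}\setminus\{0\}$, is $\mathcal{K}[f](x)=\frac{1}{|x|^{n-1}}f\left(\frac{x}{|x|^2}\right)$. Gegenbauer polynomials: $C_k^\lambda(z)=\sum_{j=0}^{\lfloor k/2\rfloor}(-1)^j\frac{\Gamma(k-j+\lambda)}{\Gamma(\lambda)\,j!\,(k-2j)!}(2z)^{k-2j}$. Zonal harmonics: for $\lambda=\frac{n-1}{2}>0$, $Z_k^\lambda(x,y)=\frac{k+\lambda}{\lambda}C_k^\lambda\left(\frac{\langle x,y\rangle}{|x||y|}\right)(|x||y|)^k$ on $\mathbb{R}^{n+1}$.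 *)

(* Defs.v *)
From HB Require Import structures.
From mathcomp Require Import all_boot all_order all_algebra.
From mathcomp Require Import all_classical all_reals all_analysis.

Set Implicit Arguments.
Unset Strict Implicit.
Unset Printing Implicit Defensive.

Import Order.TTheory GRing.Theory Num.Theory.
Import numFieldNormedType.Exports.

Local Open Scope classical_set_scope.
Local Open Scope ring_scope.

Definition dotp (R : realType) (m : nat) (x y : 'rV[R]_m) : R :=
  \sum_(j < m) x 0 j * y 0 j.

(* The library norm `|x| on 'rV[R]_m is the sup norm, hence a separate
   Euclidean norm; both induce the same topology. *)
Definition enorm (R : realType) (m : nat) (x : 'rV[R]_m) : R :=
  Num.sqrt (dotp x x).

(* <y, nabla_x> f = sum_j y_j (partial_j f), the partial derivative being the
   library's derivative along the j-th vector of the standard basis. *)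
Definition dir_nabla (R : realType) (m : nat) (y : 'rV[R]_m)
    (f : 'rV[R]_m -> R) : 'rV[R]_m -> R :=
  fun x => \sum_(j < m) y 0 j * 'D_(delta_mx 0 j) f x.

(* Functions on R^(n+1) \ {0} are represented by total functions. The value at
   the origin is irrelevant: the inversion x / |x|^2 preserves R^(n+1) \ {0} and
   a derivative at x != 0 only depends on the function near x. *)
Definition kelvin (R : realType) (n : nat) (f : 'rV[R]_n.+1 -> R) :
    'rV[R]_n.+1 -> R :=
  fun x => (enorm x ^+ (n - 1))^-1 * f ((enorm x ^+ 2)^-1 *: x).

(* Euler's integral; meaningful for a > 0. *)
Definition Gamma (R : realType) (a : R) : R :=
  \int[lebesgue_measure]_(t in `]0, +oo[) (t `^ (a - 1) * expR (- t)).

Definition gegenbauer (R : realType) (k : nat) (lambda z : R) : R :=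
  \sum_(j < (k./2).+1)
    (-1) ^+ j * (Gamma ((k - j)%:R + lambda)
                 / (Gamma lambda * (j`!)%:R * ((k - 2 * j)`!)%:R))
    * (2 * z) ^+ (k - 2 * j).

Definition zonal (R : realType) (m : nat) (k : nat) (lambda : R)
    (x y : 'rV[R]_m) : R :=
  (k%:R + lambda) / lambda
  * gegenbauer k lambda (dotp x y / (enorm x * enorm y))
  * (enorm x * enorm y) ^+ k.

(* Main.v *)
(* Off the origin, put s = <x, y>, r = |x|^2 and let P_k(x) be (-1)^k k! times
   the two-variable Gegenbauer form sum_j a_(k,j) (2 s)^(k - 2 j) (r |y|^2)^j,
   which is homogeneous of degree k in x. Homogeneity gives
   K[P_k] = |x|^(-2 (lambda + k)) P_k, so that
   <y, nabla> K[P_k]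
     = |x|^(-2 (lambda + k + 1)) (r <y, nabla> P_k - 2 (lambda + k) s P_k).
   The three-term relation between the coefficients a_(k,j) says that the last
   factor is P_(k+1), and a second inversion removes the power of |x|.
   The coefficients are ratios Gamma (k - j + lambda) / Gamma lambda, which are
   rising factorials because Euler's integral converges, is positive and
   satisfies Gamma (a + 1) = a Gamma a for all a > 0. *)
Require Import Defs.
From HB Require Import structures.
From mathcomp Require Import all_boot all_order all_algebra.
From mathcomp Require Import all_classical all_reals all_analysis.
From mathcomp Require Import measurable_realfun zify ring lra.
Import Order.TTheory GRing.Theory Num.Theory.
Import numFieldNormedType.Exports.
Local Open Scope classical_set_scope.
Local Open Scope ring_scope.

(** * Euler's Gamma integral: functional equation, convergence, positivity *)

Definition gamma_fun {R : realType} (a t : R) : R := t `^ (a - 1) * expR (- t).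

(* Extended-real valued: the functional equation is proved before finiteness,
   which is then deduced from it (convergence at 0 for a < 1 in particular). *)
Definition eGamma {R : realType} (a : R) : \bar R :=
  (\int[@lebesgue_measure R]_(t in `]0%R, +oo[) (gamma_fun a t)%:E)%E.

Lemma gamma_fun_ge0 {R : realType} (a t : R) : 0 <= gamma_fun a t.
Proof. by rewrite mulr_ge0 ?powR_ge0 ?expR_ge0. Qed.

Lemma measurable_gamma_fun {R : realType} (a : R) (D : set R) :
  measurable D -> measurable_fun D (EFin \o gamma_fun a).
Proof.
move=> mD; apply/measurable_EFinP; apply: measurable_funM.
  by apply: measurable_funTS; exact: measurable_powR.
by apply: measurableT_comp.
Qed.

(** The function is squeezed between 0 and [(m+1)! / t] with an integer [m >= a], because [expR t]
    dominates the term [t^(m+1) / (m+1)!] of its series. *)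
Lemma powR_expRN_cvg0 {R : realType} (a : R) :
  t `^ a * expR (- t) @[t --> +oo] --> (0 : R).
Proof.
pose m := (Num.truncn a).+1.
have am : a <= m%:R by rewrite ltW// /m truncnS_gt.
apply: (@squeeze_cvgr _ _ _ _ (cst 0) (fun t => (m.+1)`!%:R * t^-1)).
- near=> t; have t1 : 1 <= t by near: t; exact: nbhs_pinfty_ge.
  have t0 : 0 < t by exact: lt_le_trans t1.
  rewrite mulr_ge0 ?powR_ge0 ?expR_ge0//= expRN.
  rewrite ler_pdivrMr ?expR_gt0// mulrAC ler_pdivlMr//.
  apply: (@le_trans _ _ (t ^+ m.+1)).
    rewrite exprSr ler_pM2r// -powR_mulrn ?(ltW t0)//.
    exact: ler_powR.
  rewrite -ler_pdivrMl ?ltr0n ?fact_gt0//.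
  apply: le_trans (expR_ge1Dxn m (ltW t0)).
  by rewrite mulrC lerDr.
- exact: cvg_cst.
- rewrite -[X in _ --> X](mulr0 (m.+1)`!%:R).
  apply: cvgM; first exact: cvg_cst.
  by apply/gtr0_cvgV0; [exact: nbhs_pinfty_gt|exact: cvg_id].
Unshelve. all: by end_near. Qed.

(** On a compact interval inside the positive axis every function involved is smooth, so integration
    by parts applies; the endpoints are sent to 0 and infinity in [eGammaS]. *)
Lemma powR_expRN_parts {R : realType} (a c d : R) : 0 < a -> 0 < c -> c < d ->
  (\int[@lebesgue_measure R]_(t in `[c, d]) (gamma_fun (a + 1) t)%:E =
   (c `^ a * expR (- c) - d `^ a * expR (- d))%:E +
   a%:E * \int[@lebesgue_measure R]_(t in `[c, d]) (gamma_fun a t)%:E)%E.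
Proof.
move=> a0 c0 cd.
have pos (t : R) : c <= t -> 0 < t by exact: lt_le_trans.
have dpow (b t : R) : c <= t -> is_derive t 1 (@powR R ^~ b) (b * t `^ (b - 1)).
  by move=> /pos t0; exact: is_derive1_powR.
have dexp (t : R) : is_derive t 1 (fun t : R => expR (- t)) (- expR (- t)).
  by apply: is_derive_eq; rewrite ?mulrN1.
have dexpN (t : R) : is_derive t 1 (fun t : R => - expR (- t)) (expR (- t)).
  by apply: is_derive_eq; rewrite ?opprK.
have cts (f : R -> R) (df : R -> R) :
    (forall t, c <= t -> is_derive t 1 f (df t)) ->
    {within `[c, d], continuous f}.
  move=> fdf; apply: derivable_within_continuous => t.
  by rewrite in_itv/= => /andP[ct _]; have [] := fdf t ct.
have LR (f df : R -> R) :
    (forall t, c <= t -> is_derive t 1 f (df t)) ->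
    derivable_oo_LRcontinuous f c d.
  move=> fdf; have fder t : c <= t -> derivable f t 1 by move=> /fdf [].
  have fc t : c <= t -> {for t, continuous f}.
    by move=> /fder/derivable1_diffP/differentiable_continuous.
  split.
  - by move=> t; rewrite in_itv/= => /andP[/ltW ct _]; exact: fder.
  - by apply: cvg_at_right_filter; exact: fc.
  - by apply: cvg_at_left_filter; apply: fc; exact: ltW.
have dE (f df : R -> R) :
    (forall t, c <= t -> is_derive t 1 f (df t)) ->
    {in `]c, d[, derive1 f =1 df}.
  move=> fdf t; rewrite in_itv/= => /andP[/ltW ct _].
  by rewrite derive1E; have [_ ->] := fdf t ct.
have := @integration_by_parts R (@powR R ^~ a) (fun t => - expR (- t))
  (fun t => a * t `^ (a - 1)) (fun t => expR (- t)) c d cd.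
move=> parts; rewrite (_ : integral _ _ _ =
  (\int[@lebesgue_measure R]_(x in `[c, d]) (x `^ a * expR (- x))%:E)%E);
  last first.
  by apply: eq_integral => t _; rewrite /gamma_fun addrK.
rewrite {}parts; first last.
- by apply: dE => t _; exact: dexpN.
- by apply: (LR _ (fun t => expR (- t))) => t _; exact: dexpN.
- by apply: cts => t _; exact: dexp.
- by apply: dE => t; exact: dpow.
- by apply: LR => t; exact: dpow.
- apply: (cts _ (fun t => a * ((a - 1) * t `^ (a - 1 - 1)))) => t ct.
  by have ? := dpow (a - 1) t ct; apply: is_derive_eq.
rewrite !mulrN opprK; congr (_%:E + _)%E; first by rewrite addrC.
under eq_integral do rewrite mulrN -mulrA EFinN EFinM.
rewrite integral_ge0N ?oppeK; last first.
  by move=> t _; rewrite mule_ge0 ?lee_fin ?(ltW a0)// gamma_fun_ge0.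
rewrite ge0_integralZl//=.
- exact: measurable_gamma_fun.
- by move=> t _; rewrite lee_fin gamma_fun_ge0.
- by rewrite lee_fin ltW.
Qed.

(** The integration by parts is taken along compact intervals exhausting the positive axis: the
    integrals converge monotonically in the extended reals and the boundary terms tend to 0. *)
Lemma eGammaS {R : realType} (a : R) : 0 < a ->
  (eGamma (a + 1) = a%:E * eGamma a)%E.
Proof.
move=> a0.
(* Using [n.+2] keeps the endpoints distinct; [n.+1] would give the degenerate interval [1, 1] at
   [n = 0]. *)
pose F (n : nat) : set R := `[n.+2%:R^-1, n.+2%:R]%classic.
have F0 n t : F n t -> 0 < t.
  by rewrite /F/= in_itv/= => /andP[+ _]; apply: lt_le_trans.
have bF : \bigcup_n F n = `]0, +oo[%classic.
  apply/seteqP; split=> t; first by case=> n _ /F0 t0; rewrite /= in_itv/= t0.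
  rewrite /= in_itv/= andbT => t0.
  exists (Num.truncn t + Num.truncn t^-1)%N => //.
  rewrite /F/= in_itv/=; apply/andP; split.
    rewrite -[leRHS]invrK lef_pV2 ?posrE ?invr_gt0//.
    by rewrite (le_trans (ltW (truncnS_gt _)))// ler_nat ltnS leqW// leq_addl.
  by rewrite (le_trans (ltW (truncnS_gt _)))// ler_nat ltnS leqW// leq_addr.
have ndF : nondecreasing_seq F.
  move=> i j ij; rewrite subsetEset => t.
  rewrite /F/= !in_itv/= => /andP[it ti].
  by rewrite (le_trans _ it) ?(le_trans ti) ?ler_nat//
    ?lef_pV2 ?posrE ?ler_nat//.
have cF b : (\int[@lebesgue_measure R]_(t in F n) (gamma_fun b t)%:E
    @[n --> \oo] --> eGamma b)%E.
  rewrite /eGamma -bF; apply: ge0_nondecreasing_set_cvg_integral => //.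
  - by move=> n; apply: measurable_itv.
  - by move=> n; apply: measurable_gamma_fun; rewrite /F; exact: measurable_itv.
  - by move=> n t _; rewrite lee_fin gamma_fun_ge0.
have ny : (n.+2%:R : R) @[n --> \oo] --> +oo.
  apply/cvgryPge => M; near=> n.
  apply: (@le_trans _ _ n%:R); last by rewrite ler_nat; lia.
  by near: n; exact: nbhs_infty_ger.
pose B n : R := n.+2%:R^-1 `^ a * expR (- n.+2%:R^-1)
  - n.+2%:R `^ a * expR (- n.+2%:R).
have B0 : B n @[n --> \oo] --> (0 : R).
  rewrite -[X in _ --> X]subr0; apply: cvgB; last first.
    exact: cvg_comp ny (powR_expRN_cvg0 a).
  have n0 : (n.+2%:R^-1 : R) @[n --> \oo] --> 0.
    by apply/gtr0_cvgV0 => //; near=> n; rewrite ltr0n.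
  rewrite -(mul0r (expR (- 0))); apply: cvgM.
    by apply: (cvg_at_rightP _ _ _).1 (powR_cvg0 a0) _ _; split.
  by apply: (cvg_comp _ _ (cvgN n0)); exact: continuous_expR.
have RHS : ((B n)%:E
    + a%:E * \int[@lebesgue_measure R]_(t in F n) (gamma_fun a t)%:E)%E
    @[n --> \oo] --> (0 + a%:E * eGamma a)%E.
  apply: cvgeD; first by rewrite fin_num_adde_defr.
    by apply: cvg_EFin; [exact: nearW|exact: B0].
  exact: cvgeZl.
rewrite add0e in RHS.
apply: cvg_unique RHS => //.
apply: cvg_trans (cF (a + 1)).
apply: near_eq_cvg; near=> n.
rewrite powR_expRN_parts ?invr_gt0//.

by rewrite (@lt_trans _ _ 1) ?invf_lt1 ?ltr1n.
Unshelve. all: by end_near. Qed.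

Lemma eGamma1 {R : realType} : eGamma (1 : R) = 1%E.
Proof.
rewrite /eGamma /gamma_fun; under eq_integral do rewrite subrr powRr0 mul1r.
rewrite integral_itv_obnd_cbnd; last first.
  by apply/measurable_EFinP; apply: measurableT_comp.
have cE : continuous (fun t : R => expR (- t)).
  move=> t; apply/differentiable_continuous/derivable1_diffP.
  exact: ex_derive.
rewrite (@ge0_continuous_FTC2y R _ (fun t => - expR (- t)) 0 0).
- by rewrite oppr0 expR0 sub0e EFinN oppeK.
- by move=> t _; exact: expR_ge0.
- exact: continuous_subspaceT.
- by rewrite -oppr0; apply: cvgN; exact: cvgr_expR.
- by move=> t _; apply: ex_derive.
- by apply: cvgN; apply: cvg_at_right_filter; exact: cE.
- move=> t _; rewrite derive1E; apply: derive_val.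
  by apply: is_derive_eq; rewrite ?mulrN1 ?opprK.
Qed.

Lemma eGamma_nat {R : realType} (n : nat) : eGamma (n.+1%:R : R) = (n`!%:R)%:E.
Proof.
elim: n => [|n IH]; first exact: eGamma1.
by rewrite -addn1 natrD eGammaS// IH -EFinM -natrM -factS.
Qed.

Lemma eGamma_ge0 {R : realType} (a : R) : (0 <= eGamma a)%E.
Proof. by apply: integral_ge0 => t _; rewrite lee_fin gamma_fun_ge0. Qed.

(** An infinite value at [a] would propagate to [a + 1]. There the exponent is [a > 0], and
    [t^a <= 1 + t^m] with an integer [m >= a] bounds the integral by [eGamma 1 + eGamma m.+1%:R]. *)
Lemma eGamma_fin_num {R : realType} (a : R) : 0 < a -> eGamma a \is a fin_num.
Proof.
move=> a0; suff S : eGamma (a + 1) \is a fin_num.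
  rewrite ge0_fin_numE ?eGamma_ge0// ltey; apply/eqP => Ea.
  by move: S; rewrite eGammaS// Ea gt0_muley// lte_fin.
pose m := (Num.truncn a).+1.
have am : a <= m%:R by rewrite ltW// /m truncnS_gt.
rewrite ge0_fin_numE ?eGamma_ge0//.
apply: (@le_lt_trans _ _ (eGamma 1 + eGamma m.+1%:R)%E); last first.
  by rewrite eGamma1 eGamma_nat -EFinD ltry.
rewrite /eGamma -ge0_integralD//=.
- apply: ge0_le_integral => //=.
  + by move=> t _; rewrite lee_fin gamma_fun_ge0.
  + exact: measurable_gamma_fun.
  + by apply: emeasurable_funD; exact: measurable_gamma_fun.
  move=> t; rewrite in_itv/= andbT => t0.
  rewrite -EFinD lee_fin /gamma_fun -mulrDl ler_pM2r ?expR_gt0//.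
  rewrite subrr powRr0 -natr1 !addrK powR_mulrn ?(ltW t0)//=.
  have [t1|t1] := leP t 1.
    rewrite (@le_trans _ _ 1) ?lerDl ?exprn_ge0 ?(ltW t0)//.
    by rewrite -(powRr0 t) ger_powR ?t0 ?t1 ?ltW.
  rewrite (le_trans (ler_powR (ltW t1) am))// powR_mulrn ?(ltW t0)// lerDr//.
- by move=> t _; rewrite lee_fin gamma_fun_ge0.
- exact: measurable_gamma_fun.
- by move=> t _; rewrite lee_fin gamma_fun_ge0.
- exact: measurable_gamma_fun.
Qed.

Lemma GammaS {R : realType} (a : R) : 0 < a -> Gamma (a + 1) = a * Gamma a.
Proof.
move=> a0; rewrite /Gamma /Rintegral.
have := eGammaS a a0; rewrite /eGamma /gamma_fun => ->.
by rewrite fineM//; exact: eGamma_fin_num.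
Qed.

(** On [1, 2] the integrand is at least [c], since [t^(a - 1) >= t^(-1) >= 1/2] and
    [expR (- t) >= expR (- 2)]. *)
Lemma Gamma_gt0 {R : realType} (a : R) : 0 < a -> 0 < Gamma a.
Proof.
move=> a0; have fin := eGamma_fin_num a a0.
pose c : R := 2^-1 * expR (- 2).
suff : (c%:E <= eGamma a)%E.
  rewrite -(fineK fin) lee_fin; apply: lt_le_trans.
  by rewrite mulr_gt0 ?expR_gt0// invr_gt0.
apply: (@le_trans _ _ (\int[@lebesgue_measure R]_(t in `[1%R, 2%R]) c%:E)%E).
  rewrite integral_cst//= lebesgue_measure_itv/= lte_fin ltrDl ltr01 -EFinD.
  by rewrite -addrA subrr addr0 mule1.
apply: (@le_trans _ _
  (\int[@lebesgue_measure R]_(t in `[1%R, 2%R]) (gamma_fun a t)%:E)%E).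
  apply: ge0_le_integral => //=.
  - by move=> t _; rewrite lee_fin mulr_ge0 ?expR_ge0// invr_ge0.
  - exact: measurable_gamma_fun.
  move=> t; rewrite in_itv/= => /andP[t1 t2]; rewrite lee_fin.
  have t0 : 0 < t by exact: lt_le_trans t1.
  rewrite ler_pM ?expR_ge0 ?invr_ge0 ?ler_expR ?lerN2//.
  apply: (@le_trans _ _ (t `^ (- 1))).
rewrite powR_inv1 ?(ltW t0)// lef_pV2 ?posrE//.
  by apply: ler_powR => //; lra.
apply: ge0_subset_integral => //=.
- exact: measurable_gamma_fun.
- by move=> t _; rewrite lee_fin gamma_fun_ge0.
- move=> t; rewrite /= !in_itv/= => /andP[t1 _].
  by rewrite andbT (lt_le_trans _ t1).
Qed.

(** * Euclidean inner product and norm, and their directional derivatives *)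

Lemma dotpC {R : realType} {m : nat} (x y : 'rV[R]_m) : dotp x y = dotp y x.
Proof. by apply: eq_bigr => j _; rewrite mulrC. Qed.

Lemma dotpZl {R : realType} {m : nat} (c : R) (x y : 'rV[R]_m) :
  dotp (c *: x) y = c * dotp x y.
Proof. by rewrite mulr_sumr; apply: eq_bigr => j _; rewrite mxE mulrA. Qed.

Lemma dotp_ge0 {R : realType} {m : nat} (x : 'rV[R]_m) : 0 <= dotp x x.
Proof. by apply: sumr_ge0 => j _; rewrite -expr2 sqr_ge0. Qed.

Lemma dotp_gt0 {R : realType} {m : nat} (x : 'rV[R]_m) : x != 0 -> 0 < dotp x x.
Proof.
move=> x0; rewrite lt_neqAle dotp_ge0 andbT eq_sym; apply: contra x0 => /eqP.
move/psumr_eq0P => h; apply/eqP/rowP => j; rewrite mxE.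
by apply/eqP; rewrite -sqrf_eq0 expr2 h// => i _; rewrite -expr2 sqr_ge0.
Qed.

Lemma enorm_gt0 {R : realType} {m : nat} (x : 'rV[R]_m) : x != 0 -> 0 < enorm x.
Proof. by move=> x0; rewrite sqrtr_gt0 dotp_gt0. Qed.

Lemma enorm_sqr {R : realType} {m : nat} (x : 'rV[R]_m) :
  enorm x ^+ 2 = dotp x x.
Proof. by rewrite sqr_sqrtr ?dotp_ge0. Qed.

Lemma enormZ {R : realType} {m : nat} (c : R) (x : 'rV[R]_m) :
  enorm (c *: x) = `|c| * enorm x.
Proof.
by rewrite /enorm dotpZl dotpC dotpZl mulrA -expr2 sqrtrM ?sqr_ge0// sqrtr_sqr.
Qed.

Lemma dotp_delta {R : realType} {m : nat} (x : 'rV[R]_m) (j : 'I_m) :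
  dotp (delta_mx 0 j) x = x 0 j.
Proof.
rewrite /dotp (bigD1 j)//= !mxE !eqxx mul1r big1 ?addr0// => i ij.
by rewrite mxE (negPf ij) andbF mul0r.
Qed.

Lemma is_derive_coord {R : realType} {m : nat} (j : 'I_m) (x v : 'rV[R]_m) :
  is_derive x v (fun z : 'rV[R]_m => z 0 j : R) (v 0 j).
Proof.
apply: DeriveDef; first exact/diff_derivable/differentiable_coord.
have := @derive_mx R _ 1 m id x v (@derivable_id _ _ _ _).
by rewrite derive_id => /matrixP/(_ 0 j); rewrite mxE.
Qed.

Lemma is_derive_dotp {R : realType} {m : nat} (y x v : 'rV[R]_m) :
  is_derive x v (fun z => dotp z y) (dotp v y).
Proof.
rewrite (_ : (fun z => dotp z y) =
  \sum_(j < m) (fun z : 'rV[R]_m => z 0 j * y 0 j)); last first.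
  by apply/funext => z; rewrite fct_sumE.
apply: is_derive_sum => j.
have ? := is_derive_coord j x v.
by apply: is_derive_eq; rewrite scaler0 add0r /GRing.scale/= mulrC.
Qed.

Lemma is_derive_dotp_sqr {R : realType} {m : nat} (x v : 'rV[R]_m) :
  is_derive x v (fun z => dotp z z) (2 * dotp v x).
Proof.
rewrite (_ : (fun z => dotp z z) =
  \sum_(j < m) (fun z : 'rV[R]_m => z 0 j * z 0 j)); last first.
  by apply/funext => z; rewrite fct_sumE.
rewrite mulr_sumr; apply: is_derive_sum => j.
have ? := is_derive_coord j x v.
by apply: is_derive_eq; rewrite /GRing.scale/=; ring.
Qed.

(** Restricting to the line [t *: v + x] turns the directional derivative into an ordinary one at
    [t = 0], where the one-variable chain rule applies. Only derivability of [f] along [v] is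
    required. *)
Lemma is_derive_comp_dir {R : realType} {V : normedModType R} (g : R -> R)
    (f : V -> R) (x v : V) (a b : R) :
  is_derive (f x) 1 g a -> is_derive x v f b -> is_derive x v (g \o f) (a * b).
Proof.
have line (h : V -> R) c :
    is_derive x v h c <-> is_derive (0 : R) 1 (fun t : R => h (t *: v + x)) c.
  have E : 'D_v h x = 'D_1 (fun t : R => h (t *: v + x)) 0.
    rewrite /derive; set g1 := fun h => h^-1 *: _; set g2 := fun h => h^-1 *: _.
    suff -> : g1 = g2 by [].
    by rewrite funeqE /g1 /g2 => t /=; rewrite addr0 scale0r add0r [_%:A]mulr1.
  split=> -[dh <-]; [rewrite E|rewrite -E]; (apply: DeriveDef; last by []).
    exact: (derivable1P _ _ _).1.
  exact: (derivable1P _ _ _).2.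
move=> dg /line df; apply/line.
apply: is_derive1_comp.
by rewrite scale0r add0r.
Qed.

Lemma is_derive_enormV {R : realType} {m : nat} (N : nat) (x v : 'rV[R]_m) :
  x != 0 ->
  is_derive x v (fun z : 'rV[R]_m => (enorm z ^+ N)^-1)
    (- N%:R * dotp v x / enorm x ^+ (N.+2)).
Proof.
move=> x0; have r0 := dotp_gt0 x x0; have e0 := enorm_gt0 x x0.
have ? := is_derive_dotp_sqr x v.
have ? : is_derive (dotp x x) 1 (fun r : R => (Num.sqrt r ^+ N)^-1)
   (- N%:R / (2 * enorm x ^+ N.+2)).
  have ? := is_derive1_sqrt r0.
  have n0 : ((@Num.sqrt R) ^+ N) (dotp x x) != 0.
    by rewrite exprfctE expf_neq0// gt_eqF.
  have D := @is_deriveV R (@Num.sqrt R ^+ N) (dotp x x) _ 1 n0 (is_deriveX _ _).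
  rewrite (_ : (fun r : R => _) = (fun r => ((@Num.sqrt R ^+ N) r)^-1));
    last first.
    by apply/funext => r; rewrite exprfctE.
  apply: is_derive_eq.
  rewrite exprfctE -/(enorm x).
  rewrite /GRing.scale/=.
  (* The power rule yields the exponent [N.-1], which is a true predecessor only for positive
     [N]. *)
  case: N {n0 D} => [|N]; first by rewrite !mul0r mulr0 oppr0 mul0r.
  rewrite [N.+1.-1]/= !exprS.
  by field; rewrite ?expf_neq0 ?gt_eqF.
have D := is_derive_comp_dir (fun r : R => (Num.sqrt r ^+ N)^-1)
  (fun z : 'rV[R]_m => dotp z z) x v.
apply: is_derive_eq (D _ _ _ _) _ => //.
by rewrite !exprS; field; rewrite ?expf_neq0 ?gt_eqF.
Qed.

(** * Gegenbauer polynomials as homogeneous forms in two variables *)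

Lemma fact_neq0 {R : realType} (n : nat) : n`!%:R != 0 :> R.
Proof. by rewrite pnatr_eq0 -lt0n fact_gt0. Qed.

(** The Pochhammer symbol. *)
Definition rising {R : realType} (lam : R) (n : nat) : R :=
  \prod_(i < n) (i%:R + lam).

Lemma risingS {R : realType} (lam : R) (n : nat) :
  rising lam n.+1 = rising lam n * (n%:R + lam).
Proof. exact: big_ord_recr. Qed.

Lemma Gamma_rising {R : realType} (lam : R) (n : nat) : 0 < lam ->
  Gamma (n%:R + lam) = rising lam n * Gamma lam.
Proof.
move=> l0; elim: n => [|n IH]; first by rewrite /rising big_ord0 add0r mul1r.
rewrite -addn1 natrD addrAC GammaS; last by rewrite ltr_wpDl ?ler0n.
by rewrite IH addn1 risingS mulrCA mulrA.
Qed.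

(* The test avoids the truncated difference k - 2j, so that sums over j may
   run past k/2. *)
Definition geg_coef {R : realType} (lam : R) (k j : nat) : R :=
  if (j.*2 <= k)%N then
    (-1) ^+ j * rising lam (k - j) / (j`!%:R * (k - j.*2)`!%:R) else 0.

(* For u = 2 z and q = 1 this is C_k(z); q is the homogenizing variable. *)
Definition geg_hom {R : realType} (lam : R) (k : nat) (u q : R) : R :=
  \sum_(j < k.+1) geg_coef lam k j * (u ^+ (k - j.*2) * q ^+ j).

(** This and [geg_hom_dq] are the formal partial derivatives of [geg_hom]; at exponent 0 the
    numerical factor cancels the term that the truncated predecessor leaves. *)
Definition geg_hom_du {R : realType} (lam : R) (k : nat) (u q : R) : R :=
  \sum_(j < k.+1)
    geg_coef lam k j * ((k - j.*2)%:R * u ^+ (k - j.*2).-1 * q ^+ j).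

Definition geg_hom_dq {R : realType} (lam : R) (k : nat) (u q : R) : R :=
  \sum_(j < k.+1) geg_coef lam k j * (u ^+ (k - j.*2) * (j%:R * q ^+ j.-1)).

Lemma gegenbauer_hom {R : realType} (lam : R) (k : nat) (z : R) : 0 < lam ->
  gegenbauer k lam z = geg_hom lam k (2 * z) 1.
Proof.
move=> l0; rewrite /gegenbauer /geg_hom.
rewrite (big_ord_widen k.+1 (fun j => (-1) ^+ j
    * (Gamma ((k - j)%:R + lam)
       / (Gamma lam * (j`!)%:R * ((k - 2 * j)`!)%:R))
    * (2 * z) ^+ (k - 2 * j))); last by rewrite ltnS; lia.
rewrite big_mkcond; apply: eq_bigr => -[j jk] _ /=.
rewrite /geg_coef ltnS mul2n geq_half_double.
case: ifP => [jk2|]; last by rewrite mul0r.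
rewrite Gamma_rising// expr1n mulr1.
have := Gamma_gt0 lam l0 => /lt0r_neq0 G0.
by field; rewrite !fact_neq0.
Qed.

(** With weight 1 for [u] and 2 for [q], every monomial with nonzero coefficient has weight [k]. *)
Lemma geg_hom_scale {R : realType} (lam : R) (k : nat) (t u q : R) :
  geg_hom lam k (t * u) (t ^+ 2 * q) = t ^+ k * geg_hom lam k u q.
Proof.
rewrite /geg_hom mulr_sumr; apply: eq_bigr => j _.
rewrite /geg_coef; case: ifP => [jk|]; last by rewrite !mul0r mulr0.
rewrite [RHS]mulrCA; congr (_ * _).
have -> : t ^+ k = t ^+ (k - j.*2) * (t ^+ 2) ^+ j.
  by rewrite -exprM -exprD mul2n subnK.
by rewrite !exprMn; ring.
Qed.

Lemma geg_coefS0 {R : realType} (lam : R) (k : nat) :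
  k.+1%:R * geg_coef lam k.+1 0 = (k%:R + lam) * geg_coef lam k 0.
Proof.
rewrite /geg_coef !double0 !leq0n !subn0 risingS factS natrM.
by field; rewrite !fact_neq0 nat1r pnatr_eq0.
Qed.

(** The factor [k + lam - (i + 1)] lifts the rising factorial in [geg_coef lam k i.+1] to the one
    shared by the other two terms. After clearing factorials, what remains is
    [k + 1 = (k - 2i - 1) + 2(i + 1)]. *)
Lemma geg_coefSS {R : realType} (lam : R) (k i : nat) :
  k.+1%:R * geg_coef lam k.+1 i.+1 =
    (k%:R + lam - i.+1%:R) * geg_coef lam k i.+1
    - 2 * (k - i.*2)%:R * geg_coef lam k i.
Proof.
rewrite /geg_coef doubleS ltnS.
have [ki|ki] := leqP k i.*2.
  have -> : (i.*2.+2 <= k)%N = false by lia.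
  have -> : (k - i.*2 = 0)%N by lia.
  by rewrite !mulr0 mul0r subr0.
have [m ->] : exists m, k = (i.*2 + m).+1 by exists (k - i.*2.+1)%N; lia.
rewrite (leqW (leq_addr _ _)) ltnS.
have -> : ((i.*2 + m).+2 - i.+1 = (i + m).+1)%N by lia.
have -> : ((i.*2 + m).+2 - i.*2.+2 = m)%N by lia.
have -> : ((i.*2 + m).+1 - i = (i + m).+1)%N by lia.
have -> : ((i.*2 + m).+1 - i.*2 = m.+1)%N by lia.
(* For [m = 0], that is [k = 2i + 1], the coefficient [geg_coef lam k i.+1] is 0 by its test. *)
case: m => [|m].
  rewrite !addn0 ltnn !factS fact0 !natrM -muln2 -!natr1 natrM exprS.
  by field; rewrite fact_neq0 natr1 pnatr_eq0.
have -> : (i.*2 < i.*2 + m.+1)%N by lia.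
have -> : ((i.*2 + m.+1).+1 - i.+1 = (i + m).+1)%N by lia.
have -> : ((i.*2 + m.+1).+1 - i.*2.+2 = m)%N by lia.
rewrite !addnS risingS !factS !natrM -muln2 exprS -!natr1 natrD natrM.
by field; rewrite !fact_neq0 !natr1 !pnatr_eq0.
Qed.

(** Coefficients of [u^(k + 1 - 2j) q^j] are compared through [geg_coefS0] and [geg_coefSS]. For
    [u = 2 s] and [q = r |y|^2], the left side is [r <y, nabla> - 2 (lam + k) s] applied to the
    form. *)
Lemma geg_homS {R : realType} (lam : R) (k : nat) (u q : R) :
  2 * q * geg_hom_du lam k u q + u * q * geg_hom_dq lam k u q
    - (k%:R + lam) * u * geg_hom lam k u q
  = - k.+1%:R * geg_hom lam k.+1 u q.
Proof.
(* Multiplication by [q] shifts the index of the first sum by one, leaving nothing at index 0. *)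
pose T j := if j is i.+1
  then 2 * (k - i.*2)%:R * geg_coef lam k i * (u ^+ (k - i.*2).-1 * q ^+ j)
  else 0.
have -> : 2 * q * geg_hom_du lam k u q = \sum_(j < k.+2) T j.
  rewrite big_ord_recl add0r /geg_hom_du mulr_sumr; apply: eq_bigr => j _.
  by rewrite /T /= exprS; ring.
rewrite -addrA.
have -> : u * q * geg_hom_dq lam k u q
    - (k%:R + lam) * u * geg_hom lam k u q =
    \sum_(j < k.+2) (j%:R - (k%:R + lam)) * geg_coef lam k j *
      (u ^+ (k.+1 - j.*2) * q ^+ j).
  rewrite big_ord_recr/= [geg_coef lam k k.+1]/geg_coef.
  have -> : (k.+1.*2 <= k)%N = false by lia.
  rewrite mulr0 mul0r addr0 /geg_hom_dq /geg_hom !mulr_sumr -sumrB.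
  apply: eq_bigr => -[j jk] _ /=.
  have [kj|jk2] := ltnP k j.*2.
    by rewrite /geg_coef leqNgt kj !(mul0r, mulr0, subr0).
  rewrite subSn// exprS; move: (geg_coef _ _ _) (k - j.*2)%N => c p.
  by case: j {jk jk2} => [|j]; rewrite ?expr0 /= ?[q ^+ j.+1]exprS; ring.
rewrite /geg_hom mulr_sumr -big_split/=; apply: eq_bigr => -[[|i] jk] _ /=.
  have := geg_coefS0 lam k.
  by rewrite add0r sub0r mulNr mulNr => <-; ring.
have := geg_coefSS lam k i => H.
rewrite [RHS]mulrA [in RHS]mulNr H.
have -> : (k.+1 - i.+1.*2 = (k - i.*2).-1)%N by lia.
ring.
Qed.

(* The hypothesis makes the directional derivative linear in the direction, as
   is not automatic for a sum of partial derivatives. *)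
Lemma dir_nablaE {R : realType} {m : nat} (y x : 'rV[R]_m) (f : 'rV[R]_m -> R)
    (a b : R) :
  (forall v, is_derive x v f (a * dotp v y + b * dotp v x)) ->
  dir_nabla y f x = a * dotp y y + b * dotp y x.
Proof.
move=> df; rewrite /dir_nabla /dotp !mulr_sumr -big_split/=.
apply: eq_bigr => j _; have [_ ->] := df (delta_mx 0 j).
by rewrite !dotp_delta; ring.
Qed.

Lemma is_derive_geg_hom {R : realType} {m : nat} (lam b : R) (k : nat)
    (y x v : 'rV[R]_m) :
  is_derive x v (fun z => geg_hom lam k (2 * dotp z y) (dotp z z * b))
    (geg_hom_du lam k (2 * dotp x y) (dotp x x * b) * (2 * dotp v y)
     + geg_hom_dq lam k (2 * dotp x y) (dotp x x * b) * (2 * b * dotp v x)).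
Proof.
pose F j (z : 'rV[R]_m) := geg_coef lam k j *
  ((2 * dotp z y) ^+ (k - j.*2) * (dotp z z * b) ^+ j).
rewrite (_ : (fun z => _) = \sum_(j < k.+1) F j); last first.
  by apply/funext => z; rewrite fct_sumE.
set q := dotp x x * b.
rewrite /geg_hom_du /geg_hom_dq !mulr_suml -big_split/=.
apply: is_derive_sum => j.
have ? := is_derive_dotp y x v.
have ? := is_derive_dotp_sqr x v.
(* Stated with ring operations on functions, the summand can be differentiated by instance
   inference. *)
rewrite (_ : F j = geg_coef lam k j *:
  (((2 : R) *: (fun z => dotp z y)) ^+ (k - j.*2)
   * (b *: (fun z => dotp z z)) ^+ j)); last first.
  apply/funext => z; rewrite /F.
  rewrite -[RHS]/(geg_coef lam k j * ((_ ^+ _) z * (_ ^+ _) z)) !exprfctE.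
  by rewrite [dotp z z * b]mulrC.
apply: is_derive_eq.
rewrite !exprfctE /GRing.scale/= /GRing.scale/= [b * dotp x x]mulrC -/q.
ring.
Qed.

(** * Kelvin inversion of the forms and the induction on [k] *)

Lemma kelvin_eq {R : realType} (n : nat) (f g : 'rV[R]_n.+1 -> R) :
  (forall x, x != 0 -> f x = g x) ->
  forall x, x != 0 -> kelvin f x = kelvin g x.
Proof.
move=> fg x x0; rewrite /kelvin fg// scaler_eq0 (negPf x0) orbF.
by rewrite invr_eq0 expf_neq0// gt_eqF// enorm_gt0.
Qed.

(** The ball of radius [|x|] around [x] misses the origin, so both functions agree near [x]. *)
Lemma dir_nabla_eq {R : realType} (m : nat) (y : 'rV[R]_m)
    (f g : 'rV[R]_m -> R) :
  (forall x, x != 0 -> f x = g x) ->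
  forall x, x != 0 -> dir_nabla y f x = dir_nabla y g x.
Proof.
move=> fg x x0; apply: eq_bigr => j _; congr (_ * _).
apply: near_eq_derive.
have : \forall z \near x, z != 0.
  apply/nbhs_ballP; exists `|x|; first by rewrite /= normr_gt0.
  by move=> z /=; rewrite -ball_normE/=; apply: contraTneq => ->;
    rewrite subr0 ltxx.
by apply: filterS => z; exact: fg.
Qed.

(** The form [P_k] without its factor [(-1)^k k!]. *)
Definition geg_dot {R : realType} {m : nat} (lam : R) (y : 'rV[R]_m) (k : nat)
    (x : 'rV[R]_m) : R :=
  geg_hom lam k (2 * dotp x y) (dotp x x * dotp y y).

(** Inversion scales [x] by [|x|^-2], so homogeneity contributes [|x|^(-2k)]. The inner inversion
    uses [N = 0]; the outer one uses [N = n - 1 + 2(k + 1)], for which the powers of [|x|]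
    cancel. *)
Lemma kelvin_geg_dot {R : realType} (n : nat) (lam : R) (y : 'rV[R]_n.+1)
    (c : R) (N k : nat) (x : 'rV[R]_n.+1) : x != 0 ->
  kelvin (fun z => c * ((enorm z ^+ N)^-1 * geg_dot lam y k z)) x =
  c * (enorm x ^+ N / enorm x ^+ (n - 1 + k.*2) * geg_dot lam y k x).
Proof.
move=> x0; have e0 : enorm x != 0 by rewrite gt_eqF// enorm_gt0.
rewrite /kelvin enormZ ger0_norm ?invr_ge0 ?exprn_ge0 ?sqrtr_ge0//.
rewrite /geg_dot !dotpZl (dotpC x (_ *: x)) dotpZl.
set t := (enorm x ^+ 2)^-1.
have -> : 2 * (t * dotp x y) = t * (2 * dotp x y) by ring.
have -> : t * (t * dotp x x) * dotp y y = t ^+ 2 * (dotp x x * dotp y y).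
  by ring.
rewrite geg_hom_scale {}/t !exprMn exprD -mul2n exprM !exprVn -!exprM.
rewrite (mulnC 2 N) exprM.
by field; rewrite !expf_neq0.
Qed.

Lemma kelvin_conj_dir_nabla {R : realType} (n : nat) (y : 'rV[R]_n.+1)
    (k : nat) (c : R) (x : 'rV[R]_n.+1) : (1 <= n)%N -> x != 0 ->
  let lam : R := (n%:R - 1) / 2 in
  kelvin (dir_nabla y (kelvin (fun z => c * geg_dot lam y k z))) x =
  - k.+1%:R * c * geg_dot lam y k.+1 x.
Proof.
move=> n1 x0 lam; set P := geg_dot lam y.
pose N := (n - 1 + k.*2)%N.
have K z : z != 0 ->
    kelvin (fun z => c * P k z) z = c * ((enorm z ^+ N)^-1 * P k z).
  move=> z0; have := kelvin_geg_dot n lam y c 0 k z z0.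
  rewrite expr0 div1r => <-; congr kelvin; apply/funext => w.
  by rewrite expr0 invr1 mul1r.
have D z : z != 0 -> dir_nabla y (kelvin (fun z => c * P k z)) z =
    (- k.+1%:R * c) * ((enorm z ^+ N.+2)^-1 * P k.+1 z).
  move=> z0; rewrite (dir_nabla_eq _ y _ _ K)//.
  set u := 2 * dotp z y; set q := dotp z z * dotp y y.
  have e0 : enorm z != 0 by rewrite gt_eqF// enorm_gt0.
  have E v : is_derive z v (fun z => c * ((enorm z ^+ N)^-1 * P k z))
    (c * (enorm z ^+ N)^-1 * 2 * geg_hom_du lam k u q * dotp v y
     + c * ((enorm z ^+ N)^-1 * 2 * dotp y y * geg_hom_dq lam k u q
        - N%:R / enorm z ^+ N.+2 * geg_hom lam k u q) * dotp v z).
    have ? := is_derive_enormV N z v z0.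
    have ? := is_derive_geg_hom lam (dotp y y) k y z v.
    rewrite (_ : (fun z => _) = c *: ((fun z => (enorm z ^+ N)^-1) * P k))//.
    apply: is_derive_eq.
    rewrite /GRing.scale/= /P /geg_dot -/u -/q.
    by ring.
  rewrite (dir_nablaE _ _ _ _ _ E).
  (* The choice of [lam] enters here: the exponent of [|z|] supplies exactly the factor that
     [geg_homS] requires. *)
  have -> : N%:R = 2 * (k%:R + lam) :> R.
    rewrite /N natrD natrB// /lam -muln2 natrM.
    by field.
  have := geg_homS lam k u q; rewrite -/u -/q.
  rewrite -/(P k.+1 z) [dotp y z]dotpC => H.
  have -> : - k.+1%:R * c * ((enorm z ^+ N.+2)^-1 * P k.+1 z) =
    c * (enorm z ^+ N.+2)^-1 * (- k.+1%:R * P k.+1 z) by ring.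
  rewrite -H !exprS /u /q -enorm_sqr.
  by field; rewrite e0 expf_neq0.
rewrite (kelvin_eq n _ _ D)// kelvin_geg_dot//.
have -> : (n - 1 + k.+1.*2)%N = N.+2 by rewrite /N; lia.
by rewrite divff ?mul1r// expf_neq0// gt_eqF// enorm_gt0.
Qed.

(** Each step contributes [-(k + 1)]. The induction hypothesis holds only off the origin, so it
    passes under the operators through [kelvin_eq] and [dir_nabla_eq]. *)
Lemma iter_kelvin_conj_dir_nabla {R : realType} (n : nat) (y : 'rV[R]_n.+1)
    (k : nat) (x : 'rV[R]_n.+1) : (1 <= n)%N -> x != 0 ->
  iter k (fun f : 'rV[R]_n.+1 -> R => kelvin (dir_nabla y (kelvin f)))
    (fun _ => 1) x =
  (-1) ^+ k * k`!%:R * geg_dot ((n%:R - 1) / 2) y k x.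
Proof.
move=> n1; elim: k x => [|k IH] x x0.
  rewrite /geg_dot /geg_hom big_ord1 /geg_coef /rising big_ord0 /=.
  by rewrite !expr0 !mulr1 divff// mul1r.
rewrite iterS (kelvin_eq n _ (dir_nabla y
  (kelvin (fun z => (-1) ^+ k * k`!%:R * geg_dot ((n%:R - 1) / 2) y k z))))//.
  rewrite kelvin_conj_dir_nabla// exprS factS natrM; ring.
by apply: dir_nabla_eq; exact: kelvin_eq.
Qed.

Theorem theorem2p2 (R : realType) (n : nat) (hn : (2 <= n)%N)
    (y : 'rV[R]_n.+1) (hy : y != 0) (k : nat)
    (x : 'rV[R]_n.+1) (hx : x != 0) :
  let lambda : R := (n%:R - 1) / 2 in
  let w : R := dotp x y / (enorm x * enorm y) in
  iter k (fun f : 'rV[R]_n.+1 -> R => kelvin (dir_nabla y (kelvin f)))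
       (fun _ => 1) x
    = (-1) ^+ k * (k`!)%:R * gegenbauer k lambda w * (enorm x * enorm y) ^+ k
  /\
  (-1) ^+ k * (k`!)%:R * gegenbauer k lambda w * (enorm x * enorm y) ^+ k
    = (-1) ^+ k * (k`!)%:R * (lambda / (lambda + k%:R)) * zonal k lambda x y.
Proof.
move=> lambda w.
have l0 : 0 < lambda by rewrite divr_gt0// subr_gt0 ltr1n.
have e0 : enorm x * enorm y != 0 by rewrite mulf_neq0// gt_eqF// enorm_gt0.
split; last first.
  (* The second equality only cancels [(k + lambda) / lambda] against its inverse. *)
  rewrite /zonal -/w; field.
  by rewrite !gt_eqF// ltr_pwDl.
rewrite iter_kelvin_conj_dir_nabla//; last exact: ltnW.
rewrite -[RHS]mulrA; congr (_ * _).
(* Scaling by [t = |x||y|] absorbs the power: [t * 2w = 2 <x, y>] and [t^2 = |x|^2 |y|^2]. *)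
rewrite gegenbauer_hom// [RHS]mulrC -geg_hom_scale.
congr (geg_hom _ _ _ _); first by rewrite [RHS]mulrCA [_ * w]mulrC divfK.
by rewrite mulr1 exprMn !enorm_sqr.
Qed.
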